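(* Let $p>2$ be a prime and $n\ge 4$. Let $a_{i,j,k}\in\mathbf{F}_p$ (for $1\le i\le n$, $1\le j<k\le n$) be such that the group $$G=\Big\langle x_1,\dots,x_n : [[x_i,x_j],x_k]=1 \text{ for all } i,j,k,\quad x_i^{p}=\prod_{j<k}[x_j,x_k]^{a_{i,j,k}} \text{ for all } i\Big\rangle$$ satisfies all of the following: - $G$ has nilpotence class two; - $G$ has order $p^{\,n+\binom n2}$; - $G/\operatorname{Frat}(G)$ has order $p^n$; - $G'=\operatorname{Frat}(G)=Z(G)$ has order $p^{\binom n2}$ and exponent $p$; - $\operatorname{Aut}(G)=\operatorname{Aut}_c(G)$, that is, all automorphisms of $G$ are central. Then $T(G)$ contains a non-abelian subgroup of order $$(p-1)\cdot p^{\binom n2\binom{n+1}2},$$ which is the extension of an $\mathbf{F}_p$-vector space of dimension $\binom n2\binom{n+1}2$ by the multiplicative group $\mathbf{F}_p^{*}$ acting naturally (that is, by scalar multiplication).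
   Context: For a group $G$, $S(G)$ is the group of permutations of the set $G$. Let $\rho:G\to S(G)$, $\rho(g):h\mapsto hg$, be the right regular representation. Put $\operatorname{Hol}(G)=N_{S(G)}(\rho(G))=\operatorname{Aut}(G)\rho(G)$, $\operatorname{NHol}(G)=N_{S(G)}(\operatorname{Hol}(G))$ and $T(G)=\operatorname{NHol}(G)/\operatorname{Hol}(G)$. $\operatorname{Frat}(G)$ is the Frattini subgroup. $\operatorname{Aut}_c(G)=\{\alpha\in\operatorname{Aut}(G): g^{-1}g^{\alpha}\in Z(G)\text{ for all } g\in G\}$ is the group of central automorphisms. It is known from earlier work that for every prime $p>2$ and every $n\ge4$ there is a choice of the $a_{i,j,k}$ for which all the listed properties hold. *)

(* Defs.v *)
From mathcomp Require Import all_boot all_order all_algebra.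
From mathcomp Require Import all_fingroup all_solvable all_field.

Set Implicit Arguments.
Unset Strict Implicit.
Unset Printing Implicit Defensive.

Local Open Scope group_scope.

(* The order of the factors of the product is immaterial, because the first
   relation makes all the commutators [~ x j, x k] central; it also gives
   [~ x j, x k] ^+ p = [~ x j ^+ p, x k] = 1, so that the exponents may be read
   in 'F_p, through their representatives in 0, ..., p - 1. *)
Definition class2_relations (p n : nat) (a : 'I_n -> 'I_n -> 'I_n -> 'F_p)
    (gT : groupType) (x : 'I_n -> gT) : Prop :=
  (forall i j k : 'I_n, [~ [~ x i, x j], x k] = 1) /\
  (forall i : 'I_n,
     x i ^+ p
     = \prod_(j < n) \prod_(k < n | (j < k)%N) [~ x j, x k] ^+ (a i j k : nat)).

(* gT is the group generated by the x i subject to class2_relations. The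
   universal property ranges over all groups, finite or not. *)
Definition class2_presented (p n : nat) (a : 'I_n -> 'I_n -> 'I_n -> 'F_p)
    (gT : finGroupType) (x : 'I_n -> gT) : Prop :=
  [/\ <<[set x i | i : 'I_n]>> = [set: gT],
      class2_relations a x
    & forall (hT : groupType) (y : 'I_n -> hT), class2_relations a y ->
        exists f : {multiplicative gT -> hT}, forall i, f (x i) = y i].

(* With G = [set: gT], the group S(G) is {perm gT}, in which permutations are
   composed from left to right. *)
Section MultipleHolomorph.

Variable gT : finGroupType.

Definition rho (g : gT) : {perm gT} := perm (mulIg g).

Definition Hol : {group {perm gT}} := 'N([set rho g | g : gT])%G.

Definition NHol : {group {perm gT}} := 'N(Hol)%G.

Definition T : {group coset_of Hol} := (NHol / Hol)%G.

Definition Aut_c : {set {perm gT}} :=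
  [set alpha in Aut [set: gT] |
    [forall g : gT, g^-1 * alpha g \in 'Z([set: gT])]].

End MultipleHolomorph.

(* A short exact sequence  0 -> F_p^m -> H -> F_p^* -> 1  in which the
   conjugation action of H on the kernel is, through the quotient F_p^*,
   multiplication by scalars. *)
Definition scalar_extension (p m : nat) (rT : finGroupType) (H : {group rT}) :
    Prop :=
  exists (iota : 'rV['F_p]_m -> rT) (phi : {morphism H >-> {unit 'F_p}}),
    [/\ injective iota,
        forall u v : 'rV['F_p]_m, iota (u + v)%R = iota u * iota v,
        [set iota v | v : 'rV['F_p]_m] = 'ker phi,
        phi @* H = [set: {unit 'F_p}]
      & forall (h : rT) (v : 'rV['F_p]_m), h \in H ->
          iota v ^ h = iota (FinRing.uval (phi h) *: v)%R].

(* Main.v *)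
Require Import Defs.
From mathcomp Require Import all_boot all_order all_algebra.
From mathcomp Require Import all_fingroup all_solvable all_field.
From mathcomp Require Import mxabelem.

Set Implicit Arguments.
Unset Strict Implicit.
Unset Printing Implicit Defensive.

(** Write V = G / Frat(G), of dimension n over F_p, and Z = Z(G) = G' =
    Frat(G), of dimension 'C(n, 2). Two families of permutations of G lie in
    NHol(G):

    - for a quadratic map q : V -> Z, the twist g |-> g q(gZ). These form a
      group isomorphic to the space of quadratic maps, of dimension 'C(n, 2) *
      'C(n.+1, 2);
    - for d in F_p^*, the power map g |-> g ^+ k with k an integer congruent
      to d^-1 modulo p. Taking for k the p-th power of a representative of
      d^-1, that is, the Teichmuller lift modulo p ^ 2, makes this exactly
      multiplicative in d, because g ^+ (p ^ 2) = 1.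

    The power map of d conjugates the twist by q to the twist by d q: the
    quadratic map contributes d^-2, taking the k-th power in Z contributes
    d^-1, and q has to be multiplied by d to compensate for the excess of the
    former. So the products of power maps and twists form the wanted extension
    inside S(G).

    They normalise Hol(G) = Aut(G) rho(G) (mem_NHol). Indeed they commute with
    Aut(G), as a central automorphism acts trivially on V, and also on Z = G'
    (Aut_c_fix_der1). Moreover each such permutation s satisfies s(g h) = s(g)
    b_h(s(g)) s(h) for a homomorphism b_h : G -> Z: the polar form of q for a
    twist, a power of a commutator for a power map. Therefore s conjugates
    rho(h) to x |-> x b_h(x) s(h), an automorphism followed by rho(s(h)).

    They meet Hol(G) trivially (power_quadratic_perm_Hol): an element of
    Hol(G) that fixes 1 is an automorphism, hence acts trivially on V, which
    forces d = 1; and a twist is an automorphism only if the polar form of q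
    vanishes, which for odd p forces q = 0. Hence the extension embeds in
    T(G). *)

Import GRing.Theory.
Local Open Scope group_scope.

(** * Semidirect products of a vector space by its homotheties *)

Section ScalarExtension.

Variables (p m : nat) (rT : finGroupType).
Variables (D : {unit 'F_p} -> rT) (K : 'rV['F_p]_m -> rT).
Hypothesis p_prime : prime p.
Hypothesis DM : {morph D : d e / d * e}.
Hypothesis KD : {morph K : u v / (u + v)%R >-> u * v}.
Hypothesis KJ : forall d u, K u ^ D d = K (FinRing.uval d *: u)%R.
Hypothesis DK1 : forall d u, D d * K u = 1 -> d = 1 /\ u = 0%R.

(* The hypotheses make this map injective, with image closed under products. *)
Let F (x : {unit 'F_p} * 'rV['F_p]_m) := D x.1 * K x.2.

Let FM d u e v : F (d, u) * F (e, v) = F (d * e, (FinRing.uval e *: u + v)%R).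
Proof. by rewrite /F /= DM KD -KJ conjgE !mulgA mulgK. Qed.

Let D1 : D 1 = 1.
Proof. by apply: (mulgI (D 1)); rewrite -DM !mulg1. Qed.

Let K0 : K 0%R = 1.
Proof. by apply: (mulgI (K 0%R)); rewrite -KD addr0 mulg1. Qed.

Let F_inj : injective F.
Proof.
case=> d u [e v] eqF.
have /DK1[ed uv] : D (e^-1 * d) * K (u - v)%R = 1.
  rewrite DM KD -!mulgA (mulgA (D d)); move: eqF; rewrite /F /= => ->.
  by rewrite !mulgA -DM mulVg D1 mul1g -KD subrr.
by congr pair; [apply/(mulgI e^-1); rewrite ed mulVg | apply/subr0_eq].
Qed.

Let K_inj : injective K.
Proof.
by move=> u v eqK; have /F_inj[]: F (1, u) = F (1, v) by rewrite /F /= eqK.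
Qed.

Let group_set_F : group_set [set F x | x : {unit 'F_p} * 'rV['F_p]_m].
Proof.
apply/group_setP; split.
  by apply/imsetP; exists (1, 0%R); rewrite // /F /= D1 K0 mulg1.
move=> _ _ /imsetP[[d u] _ ->] /imsetP[[e v] _ ->].
by rewrite FM imset_f.
Qed.

(** The affine group of homotheties and translations of F_p^m, inside rT. *)
Definition affine_group := Group group_set_F.

Lemma mem_affine_group h :
  reflect (exists d u, h = D d * K u) (h \in affine_group).
Proof.
apply: (iffP imsetP) => [[[d u] _ ->] | [d [u ->]]]; first by exists d, u.
by exists (d, u).
Qed.

Lemma card_affine_group : #|affine_group| = ((p - 1) * p ^ m)%N.
Proof.
rewrite card_imset // card_prod card_mx mul1n card_Fp // -cardsT.
by rewrite card_finField_unit card_Fp // subn1.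
Qed.

(* The quotient map onto F_p^*, read off from the unique preimage under F. *)
Let slope h := if [pick x | F x == h] is Some x then x.1 else 1.

Let slopeF d u : slope (D d * K u) = d.
Proof.
rewrite /slope; case: pickP => [[e v] /eqP | /(_ (d, u))]; last by rewrite eqxx.
by rewrite -[D d * K u]/(F (d, u)) => /F_inj[].
Qed.

Let slopeM : {in affine_group &, {morph slope : g h / g * h}}.
Proof.
move=> _ _ /mem_affine_group[d [u ->]] /mem_affine_group[e [v ->]].
by rewrite -[D d * K u]/(F (d, u)) -[D e * K v]/(F (e, v)) FM !slopeF.
Qed.

Lemma scalar_extension_affine_group : scalar_extension p m affine_group.
Proof.
exists K, (Morphism slopeM); split=> //.
- apply/setP=> h; apply/imsetP/idP => [[v _ ->] | /morphpreP[]].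
    have ->: K v = D 1 * K v by rewrite D1 mul1g.
    by apply/kerP; rewrite /= ?slopeF //; apply/mem_affine_group; exists 1, v.
  case/mem_affine_group=> d [v ->] /set1P /=; rewrite slopeF => ->.
  by exists v => //; rewrite D1 mul1g.
- apply/setP=> d; rewrite [RHS]inE; apply/imsetP.
  exists (D d * K 0%R); last by rewrite /= slopeF.
  by rewrite setIid; apply/mem_affine_group; exists d, 0%R.
- move=> h v /mem_affine_group[d [u ->]] /=; rewrite slopeF conjgM KJ.
  by rewrite conjgE -KD addrC KD mulKg.
Qed.

Lemma affine_group_nonabelian :
  (2 < p)%N -> (0 < m)%N -> ~~ abelian affine_group.
Proof.
move=> p_gt2 m_gt0.
have [d d1]: exists d : {unit 'F_p}, d != 1.
  have: (1 < #|[set: {unit 'F_p}]|)%N.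
    by rewrite card_finField_unit card_Fp //; case: (p) p_gt2 => [|[]].
  case/card_gt1P=> d [e [_ _ de]]; have [d1 | d1] := eqVneq d 1.
    by exists e; rewrite -d1 eq_sym.
  by exists d.
apply/negP=> /centsP abH; case/eqP: d1; apply: val_inj.
pose u : 'rV['F_p]_m := const_mx 1%R.
have /abH abD : D d \in affine_group.
  by apply/mem_affine_group; exists d, 0%R; rewrite K0 mulg1.
have Ku : K u \in affine_group.
  by apply/mem_affine_group; exists 1, u; rewrite D1 mul1g.
have := KJ d u; rewrite conjgE -(abD _ Ku) mulKg => /K_inj/matrixP.
by move=> /(_ 0%R (Ordinal m_gt0)); rewrite !mxE mulr1.
Qed.

End ScalarExtension.

(** * Normalising the holomorph *)

Section Holomorph.

Variable gT : finGroupType.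
Implicit Types (g h k : gT) (s t : {perm gT}).

Lemma rhoE g h : rho g h = h * g.
Proof. by rewrite permE. Qed.

Lemma mem_AutT s :
  (s \in Aut [set: gT]) = [forall g, forall h, s (g * h) == s g * s h].
Proof.
rewrite inE; apply/andP/'forall_forallP => [[_ /morphicP sM] g h | sM].
  by apply/eqP/sM; rewrite inE.
split; first by apply/subsetP=> g; rewrite inE.
by apply/morphicP=> g h _ _; apply/eqP.
Qed.

Lemma AutTM s g h : s \in Aut [set: gT] -> s (g * h) = s g * s h.
Proof. by rewrite mem_AutT => /'forall_forallP/(_ g h)/eqP. Qed.

Lemma rho_conj_Aut s g : s \in Aut [set: gT] -> rho g ^ s = rho (s g).
Proof.
move=> sA; apply/permP=> h; rewrite -[h](permKV s) permJ !rhoE.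
exact: AutTM.
Qed.

Lemma Aut_sub_Hol : Aut [set: gT] \subset Hol gT.
Proof.
apply/subsetP=> s sA; rewrite inE.
apply/subsetP=> _ /imsetP[_ /imsetP[g _ ->] ->].
by rewrite rho_conj_Aut ?imset_f.
Qed.

Lemma rhoM g h : rho (g * h) = rho g * rho h.
Proof. by apply/permP=> k; rewrite permM !rhoE mulgA. Qed.

Lemma rho_Hol g : rho g \in Hol gT.
Proof.
rewrite inE; apply/subsetP=> _ /imsetP[_ /imsetP[h _ ->] ->].
apply/imsetP; exists (h ^ g) => //.
by apply: (mulgI (rho g)); rewrite -rhoM -!conjgC rhoM.
Qed.

(** Conjugating rho g by s gives some rho k; evaluating at s 1 = 1 identifies k
    as s g, and evaluating at s h says that s is multiplicative. *)
Lemma Hol_fix1_Aut s : s \in Hol gT -> s 1 = 1 -> s \in Aut [set: gT].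
Proof.
move=> /normP sH s1; rewrite mem_AutT; apply/'forall_forallP=> h g; apply/eqP.
have: rho g ^ s \in [set rho k | k : gT] by rewrite -sH memJ_conjg imset_f.
case/imsetP=> k _ /permP sg; have /= := sg (s 1); have := sg (s h).
by rewrite !permJ !rhoE => -> ; rewrite s1 !mul1g => ->.
Qed.

Lemma Hol_Aut_rho s :
  s \in Hol gT -> exists2 t, t \in Aut [set: gT] & s = t * rho (s 1).
Proof.
move=> sH; exists (s * (rho (s 1))^-1); last by rewrite mulgKV.
apply: Hol_fix1_Aut; first by rewrite groupM ?groupV ?rho_Hol.
by rewrite permM; apply: (canLR (permK _)); rewrite rhoE mul1g.
Qed.

(** The twisted multiplicativity of s says that the conjugate of rho h by s is
    x |-> x * b h x * s h. Its first part x |-> x * b h x is an endomorphism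
    because b h is a central homomorphism, and it is bijective because it is the
    conjugate of rho h divided by rho (s h). *)
Lemma mem_NHol s (b : gT -> gT -> gT) :
    (forall h, {morph b h : x y / x * y}) ->
    (forall h x y, commute (b h x) y) ->
    (forall g h, s (g * h) = s g * b h (s g) * s h) ->
    (forall t, t \in Aut [set: gT] -> commute t s) ->
  s \in NHol gT.
Proof.
move=> bM bZ sM sAut; rewrite inE; apply/subsetP=> _ /imsetP[t tH ->].
have [a aA ->] := Hol_Aut_rho tH; set k := t 1.
rewrite conjMg groupM //.
  by rewrite conjgE sAut // mulKg (subsetP Aut_sub_Hol).
rewrite -(mulgKV (rho (s k)) (rho k ^ s)) groupM ?rho_Hol //.
set e := _ * _^-1; apply: (subsetP Aut_sub_Hol).
have eE x : e x = x * b k x.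
  rewrite permM; apply: (canLR (permK _)).
  by rewrite -[x](permKV s) permJ !rhoE sM.
rewrite mem_AutT; apply/'forall_forallP=> x y; apply/eqP.
by rewrite !eE bM -!mulgA; congr (_ * _); rewrite !mulgA bZ -mulgA.
Qed.

End Holomorph.

(** * Quadratic forms in n variables *)

Section QuadraticForms.

Variable n : nat.

Notation pairs := {ij : 'I_n * 'I_n | ij.1 <= ij.2}.

Lemma card_ordered_pairs : #|{: pairs}| = 'C(n.+1, 2).
Proof.
rewrite card_sig -sum1_card.
rewrite -(pair_big_dep xpredT (fun i j : 'I_n => i <= j) (fun _ _ => 1)%N) /=.
rewrite (exchange_big_dep xpredT) //= -bin2_sum big_nat_recl // add0n big_mkord.
apply: eq_bigr => j _; rewrite -(big_mkord (fun i => i <= j) (fun=> 1)%N).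
by rewrite -(big_nat_widen 0 j.+1 n xpredT) ?sum_nat_const_nat ?subn0 ?muln1.
Qed.

Definition ordered_pair (k : 'I_('C(n.+1, 2))) : 'I_n * 'I_n :=
  val (enum_val (cast_ord (esym card_ordered_pairs) k)).

Lemma ordered_pair_leq k : (ordered_pair k).1 <= (ordered_pair k).2.
Proof. by rewrite /ordered_pair; case: (enum_val _). Qed.

Lemma ordered_pair_inj : injective ordered_pair.
Proof. by move=> k l /val_inj/enum_val_inj/cast_ord_inj. Qed.

Local Open Scope ring_scope.

Variable F : fieldType.
Implicit Types u v w : 'cV[F]_n.

Definition monomials v : 'cV[F]_('C(n.+1, 2)) :=
  \col_k (v (ordered_pair k).1 0 * v (ordered_pair k).2 0).

(** The polar forms of the quadratic monomials, see monomialsD. *)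
Definition polar_monomials u v : 'cV[F]_('C(n.+1, 2)) :=
  \col_k (u (ordered_pair k).1 0 * v (ordered_pair k).2 0
          + v (ordered_pair k).1 0 * u (ordered_pair k).2 0).

Lemma monomialsD u v :
  monomials (u + v) = monomials u + polar_monomials u v + monomials v.
Proof. by apply/colP=> k; rewrite !mxE mulrDl !mulrDr !addrA. Qed.

Lemma monomialsZ a v : monomials (a *: v) = a ^+ 2 *: monomials v.
Proof. by apply/colP=> k; rewrite !mxE mulrACA expr2. Qed.

Lemma monomials0 : monomials 0 = 0.
Proof. by apply/colP=> k; rewrite !mxE mulr0. Qed.

Lemma polar_monomialsDl u v w :
  polar_monomials (u + v) w = polar_monomials u w + polar_monomials v w.
Proof. by apply/colP=> k; rewrite !mxE !mulrDl !mulrDr addrACA. Qed.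

Lemma polar_monomials_diag v : polar_monomials v v = monomials v *+ 2.
Proof. by apply/colP=> k; rewrite mulr2n !mxE. Qed.

(** A quadratic form that vanishes everywhere has zero coefficients: those of the
    squares are its values at the basis vectors, the others are the values of its
    polar form at pairs of distinct basis vectors. *)
Lemma monomials_span r (A : 'M[F]_(r, 'C(n.+1, 2))) :
  (forall v, A *m monomials v = 0) -> A = 0.
Proof.
move=> A0; have A0D u v : A *m polar_monomials u v = 0.
  by have := A0 (u + v); rewrite monomialsD !mulmxDr !A0 add0r addr0.
suff Ak k : A *m delta_mx k 0 = 0 :> 'cV_r.
  by apply/matrixP=> i k; have /matrixP/(_ i 0) := Ak k; rewrite -colE !mxE.
have eqk l : (l == k) = ((ordered_pair l).1 == (ordered_pair k).1)
                        && ((ordered_pair l).2 == (ordered_pair k).2).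
  by rewrite -(inj_eq ordered_pair_inj).
pose e i : 'cV[F]_n := delta_mx i 0.
have [ij | neq_ij] := eqVneq (ordered_pair k).1 (ordered_pair k).2.
  rewrite -(A0 (e (ordered_pair k).1)); congr (A *m _); apply/colP=> l.
  by rewrite !mxE !eqxx !andbT eqk -ij -natrM mulnb.
rewrite -(A0D (e (ordered_pair k).1) (e (ordered_pair k).2)).
congr (A *m _); apply/colP=> l; rewrite !mxE !eqxx !andbT eqk -!natrM !mulnb.
suff /negPf->: ~~ (((ordered_pair l).1 == (ordered_pair k).2)
                   && ((ordered_pair l).2 == (ordered_pair k).1)).
  by rewrite addr0.
apply: contra neq_ij => /andP[/eqP l1 /eqP l2].
by rewrite -val_eqE /= eqn_leq ordered_pair_leq -l1 -l2 ordered_pair_leq.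
Qed.
End QuadraticForms.

(** * The multiplicative lift of F_p^* modulo p ^ 2 *)

(** In the binomial expansion of (q * p + c) ^ p, every term but the last is
    divisible by p ^ 2. *)
Lemma expn_mod_sqr p a b :
  prime p -> (a = b %[mod p] -> a ^ p = b ^ p %[mod p ^ 2])%N.
Proof.
move=> p_pr; suff modp c : (c ^ p = (c %% p) ^ p %[mod p ^ 2])%N.
  by move=> ab; rewrite modp ab -modp.
rewrite {1}(divn_eq c p) expnDn big_ord_recr /= subnn mul1n binn mul1n.
rewrite -modnDml (eqP (dvdn_sum _ _)) // => i _.
have u_dvd : (p ^ (p - i) %| (c %/ p * p) ^ (p - i))%N.
  by rewrite expnMn dvdn_mull.
have [i0 | i_gt0] := posnP i.
  apply: dvdn_mull; apply: dvdn_mulr; apply: dvdn_trans u_dvd.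
  by rewrite i0 subn0 dvdn_exp2l ?prime_gt1.
rewrite -mulnn dvdn_mul ?prime_dvd_bin ?i_gt0 //= dvdn_mulr //.
by rewrite (dvdn_trans _ u_dvd) // dvdn_exp // subn_gt0.
Qed.

Section Teichmuller.

Variable p : nat.
Hypothesis p_prime : prime p.

Definition teichmuller (d : {unit 'F_p}) : nat := (FinRing.uval d : nat) ^ p.

Lemma natr_teichmuller d : (teichmuller d)%:R%R = FinRing.uval d :> 'F_p.
Proof. by rewrite natrX natr_Zp -[RHS]expf_card card_Fp. Qed.

Lemma teichmuller1 : teichmuller 1 = 1%N.
Proof. exact: exp1n. Qed.

Lemma teichmullerM d e :
  (teichmuller (d * e) = teichmuller d * teichmuller e %[mod p ^ 2])%N.
Proof.
rewrite /teichmuller -expnMn; apply: expn_mod_sqr => //.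
have modFp a : (a %% (Zp_trunc (pdiv p)).+2 = a %% p)%N by rewrite Fp_cast.
by rewrite /= modFp modn_mod.
Qed.

End Teichmuller.

(** * Twists and power maps of a group of class two *)

(** The maps c and z are coordinates for an extension of F_p^n by a central
    subgroup isomorphic to F_p^r, namely the image of z. *)
Section CoordinatisedGroup.

Variables (p n r : nat) (gT : finGroupType).
Variables (c : gT -> 'cV['F_p]_n) (z : 'cV['F_p]_r -> gT).
Hypothesis p_prime : prime p.
Hypothesis cM : {morph c : g h / g * h >-> (g + h)%R}.
Hypothesis c_surj : forall v, exists g, c g = v.
Hypothesis zD : {morph z : u v / (u + v)%R >-> u * v}.
Hypothesis z_inj : injective z.
Hypothesis z_central : forall w g, commute (z w) g.
Hypothesis c0P : forall g, c g = 0%R <-> exists w, g = z w.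

Implicit Types (g h : gT) (d e : {unit 'F_p}).

Let c1 : c 1 = 0%R.
Proof. by apply: (addrI (c 1)); rewrite -cM mulg1 addr0. Qed.

Let z0 : z 0%R = 1.
Proof. by apply: (mulgI (z 0%R)); rewrite -zD addr0 mulg1. Qed.

Let cz w : c (z w) = 0%R.
Proof. by apply/c0P; exists w. Qed.

Let cV g : c g^-1 = (- c g)%R.
Proof. by apply: (addrI (c g)); rewrite -cM mulgV c1 subrr. Qed.

Let cX g k : c (g ^+ k) = (k%:R *: c g)%R.
Proof.
elim: k => [|k IH]; first by rewrite scale0r expg0.
by rewrite expgS cM IH mulrS scalerDl scale1r.
Qed.

Let zX w k : z w ^+ k = z (k%:R *: w)%R.
Proof.
elim: k => [|k IH]; first by rewrite scale0r expg0.
by rewrite expgS IH -zD mulrS scalerDl scale1r.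
Qed.

Let commg_z (g h : gT) : exists w, [~ g, h] = z w.
Proof.
apply/c0P; rewrite commgEl conjgE !cM !cV.
by rewrite (addrCA (- c h)%R) addNr addr0 addNr.
Qed.

Let commg_central (g h x : gT) : commute x [~ g, h].
Proof. by have [w ->] := commg_z g h; apply/commute_sym/z_central. Qed.

Local Hint Resolve commg_central : core.

Let expg_p2 g : g ^+ (p ^ 2) = 1.
Proof.
have [w gw]: exists w, g ^+ p = z w.
  by apply/c0P; rewrite cX pchar_Fp_0 // scale0r.
by rewrite -mulnn expgM gw zX pchar_Fp_0 // scale0r.
Qed.

Implicit Types A B : 'M['F_p]_(r, 'C(n.+1, 2)).

Definition quadratic_twist A g := g * z (A *m monomials (c g))%R.

Lemma c_quadratic_twist A g : c (quadratic_twist A g) = c g.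
Proof. by rewrite cM cz addr0. Qed.

Lemma quadratic_twistD A B g :
  quadratic_twist B (quadratic_twist A g) = quadratic_twist (A + B)%R g.
Proof.
by rewrite {1}/quadratic_twist c_quadratic_twist -mulgA -zD -mulmxDl.
Qed.

Lemma quadratic_twist0 g : quadratic_twist 0%R g = g.
Proof. by rewrite /quadratic_twist mul0mx z0 mulg1. Qed.

Lemma quadratic_twistK A : cancel (quadratic_twist A) (quadratic_twist (- A)%R).
Proof. by move=> g; rewrite quadratic_twistD subrr quadratic_twist0. Qed.

Definition quadratic_perm A : {perm gT} := perm (can_inj (@quadratic_twistK A)).

Lemma quadratic_permE A g : quadratic_perm A g = g * z (A *m monomials (c g))%R.
Proof. by rewrite permE. Qed.

Lemma quadratic_permD A B :
  quadratic_perm (A + B)%R = quadratic_perm A * quadratic_perm B.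
Proof. by apply/permP=> g; rewrite permM !permE quadratic_twistD. Qed.

Let expg_teichmullerM d e g :
  g ^+ teichmuller (d * e) = g ^+ teichmuller d ^+ teichmuller e.
Proof.
rewrite -(expg_mod (teichmuller (d * e)) (expg_p2 g)) teichmullerM //.
by rewrite expg_mod // expgM.
Qed.

Lemma expg_teichmullerK d :
  cancel (fun g => g ^+ teichmuller d) (fun g => g ^+ teichmuller d^-1).
Proof. by move=> g; rewrite -expg_teichmullerM mulgV teichmuller1. Qed.

(** The exponent lifts d^-1 rather than d so that conjugation by power_perm d
    multiplies quadratic forms by d, see quadratic_permJ. *)
Definition power_perm d : {perm gT} := perm (can_inj (@expg_teichmullerK d^-1)).

Lemma power_permE d g : power_perm d g = g ^+ teichmuller d^-1.
Proof. by rewrite permE. Qed.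

Lemma power_permM d e : power_perm (d * e) = power_perm d * power_perm e.
Proof.
apply/permP=> g; rewrite permM !power_permE -expg_teichmullerM.
by congr (_ ^+ teichmuller _); rewrite invMg; apply: val_inj; rewrite /= mulrC.
Qed.

Lemma c_power_perm d g : c (power_perm d g) = (FinRing.uval d^-1 *: c g)%R.
Proof. by rewrite power_permE cX natr_teichmuller. Qed.

(** After the power map, the form sees d^-1 times the coordinates and so gains
    d^-2, whereas raising its values to a power only gains d^-1. *)
Lemma quadratic_permJ d A :
  quadratic_perm A ^ power_perm d = quadratic_perm (FinRing.uval d *: A)%R.
Proof.
apply: (mulgI (power_perm d)); rewrite -conjgC; apply/permP=> g.
rewrite !permM !quadratic_permE c_power_perm !power_permE.
rewrite expgMn; last exact/commute_sym/z_central.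
have dV : (FinRing.uval d * FinRing.uval d^-1 = 1)%R.
  by rewrite -[LHS]/(FinRing.uval (d * d^-1)) mulgV.
rewrite zX natr_teichmuller // monomialsZ -scalemxAl -!scalemxAr !scalerA.
by rewrite expr2 mulrA dV mul1r.
Qed.

Hypothesis Aut_c_id : forall s g, s \in Aut [set: gT] -> c (s g) = c g.
Hypothesis Aut_z_id : forall s w, s \in Aut [set: gT] -> s (z w) = z w.

(** The failure of the twist to be multiplicative is the polar form. *)
Lemma quadratic_perm_NHol A : quadratic_perm A \in NHol gT.
Proof.
apply: (@mem_NHol _ _ (fun h x => z (A *m polar_monomials (c x) (c h))%R)).
- by move=> h x y; rewrite cM polar_monomialsDl mulmxDr zD.
- by move=> h x y; apply: z_central.
- move=> g h; rewrite !quadratic_permE !cM cz addr0 monomialsD !mulmxDr !zD.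
  rewrite -!mulgA; congr (_ * _); rewrite !mulgA; congr (_ * _).
  by rewrite -mulgA -zD z_central.
- move=> s sA; apply/permP=> g; rewrite !permM !quadratic_permE.
  by rewrite (AutTM _ _ sA) Aut_c_id // Aut_z_id.
Qed.

(** In class two, (g h)^k = g^k h^k [h, g]^'C(k, 2). To have the last factor as a
    function of g^k rather than of g, the commutator [h, g^k] = [h, g]^k is raised
    to an inverse of k modulo p ^ 2. *)
Lemma power_perm_NHol d : power_perm d \in NHol gT.
Proof.
set k := teichmuller d^-1.
apply: (@mem_NHol _ _ (fun h x => [~ h, x] ^+ (teichmuller d * 'C(k, 2)))).
- move=> h x y; rewrite commgMR.
  have /commgP/eqP->: commute [~ h, x] y by apply/commute_sym.
  rewrite mulg1 expgMn; last by [].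
  exact: commuteX2.
- by move=> h x y; apply/commute_sym/commuteX.
- move=> g h; rewrite !power_permE -/k expMg_Rmul //.
  rewrite commgX // (expgM _ (teichmuller d)) /k.
  have := expg_teichmullerK d^-1 [~ h, g]; rewrite invgK => ->.
  by rewrite -!mulgA; congr (_ * _); apply: commuteX.
- move=> s sA; apply/permP=> g; rewrite !permM !power_permE.
  by rewrite -(autmE sA) morphX ?inE.
Qed.

(** Such a product fixes 1, so it is an automorphism if it lies in the holomorph.
    Acting trivially on the coordinates it has d = 1, and then comparing its values
    at g * g and at g shows that twice the quadratic form vanishes. *)
Lemma power_quadratic_perm_Hol d A :
    (2 < p)%N -> (0 < n)%N ->
  power_perm d * quadratic_perm A \in Hol gT -> d = 1 /\ A = 0%R.
Proof.
move=> p_gt2 n_gt0 /Hol_fix1_Aut sA; set s := _ * _ in sA.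
have {}sA : s \in Aut [set: gT].
  apply: sA; rewrite permM quadratic_permE power_permE expg1n c1.
  by rewrite monomials0 mulmx0 z0 mulg1.
have sE g : s g = power_perm d g * z (A *m monomials (c (power_perm d g)))%R.
  by rewrite permM quadratic_permE.
have d1 : d = 1.
  have [g cg] := c_surj (const_mx 1%R).
  have := Aut_c_id g sA; rewrite sE cM cz addr0 c_power_perm cg => /matrixP.
  move/(_ (Ordinal n_gt0) 0%R); rewrite !mxE mulr1 => dV1.
  by apply: (invg_inj); rewrite invg1; apply: val_inj.
split=> //; apply: monomials_span => v; have [g cg] := c_surj v.
have {}sE h : s h = h * z (A *m monomials (c h))%R.
  by rewrite sE power_permE d1 invg1 teichmuller1 expg1.
have /mulgI/z_inj : g * g * z (A *m monomials (v + v))%R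
                  = g * g * z (A *m monomials v + A *m monomials v)%R.
  rewrite -{1 2}cg -cM -sE AutTM // sE cg zD -!mulgA.
  by congr (_ * _); rewrite !mulgA z_central.
rewrite monomialsD !mulmxDr -[RHS]addr0 addrAC => /addrI.
rewrite polar_monomials_diag -scaler_nat -scalemxAr => /eqP.
rewrite scaler_eq0 => /orP[|/eqP//]; rewrite -(dvdn_pcharf (pchar_Fp p_prime)).
by rewrite gtnNdvd.
Qed.

Lemma multiple_holomorph_affine_subgroup :
    (2 < p)%N -> (0 < n)%N -> (0 < r)%N ->
  exists H : {group coset_of (Hol gT)},
    [/\ H \subset T gT,
        ~~ abelian H,
        #|H| = ((p - 1) * p ^ (r * 'C(n.+1, 2)))%N
      & scalar_extension p (r * 'C(n.+1, 2)) H].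
Proof.
move=> p_gt2 n_gt0 r_gt0.
pose D d := coset (Hol gT) (power_perm d).
pose K u := coset (Hol gT) (quadratic_perm (vec_mx u)).
have DM : {morph D : d e / d * e}.
  by move=> d e; rewrite /D power_permM morphM ?power_perm_NHol.
have KD : {morph K : u v / (u + v)%R >-> u * v}.
  by move=> u v; rewrite /K linearD quadratic_permD morphM ?quadratic_perm_NHol.
have KJ d u : K u ^ D d = K (FinRing.uval d *: u)%R.
  rewrite /K linearZ /= -quadratic_permJ.
  by rewrite morphJ ?power_perm_NHol ?quadratic_perm_NHol.
have DK1 d u : D d * K u = 1 -> d = 1 /\ u = 0%R.
  rewrite /D /K -morphM ?power_perm_NHol ?quadratic_perm_NHol //.
  move/coset_idr; rewrite groupM ?power_perm_NHol ?quadratic_perm_NHol //.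
  move/(_ isT)/power_quadratic_perm_Hol=> [] // -> u0; split=> //.
  by apply: (can_inj (@vec_mxK _ _ _)); rewrite u0 linear0.
exists (affine_group DM KD KJ); split.
- apply/subsetP=> _ /mem_affine_group[d [u ->]].
  by rewrite groupM ?mem_quotient ?power_perm_NHol ?quadratic_perm_NHol.
- by apply: affine_group_nonabelian => //; rewrite muln_gt0 r_gt0 bin_gt0.
- exact: card_affine_group.
- exact: scalar_extension_affine_group.
Qed.

End CoordinatisedGroup.

(** * Coordinates from the Frattini quotient and the centre *)

Lemma abelem_isom_colvec (p n : nat) (aT : finGroupType) (E : {group aT}) :
    prime p -> p.-abelem E -> #|E| = (p ^ n)%N ->
  exists2 f : {morphism E >-> 'cV['F_p]_n},
    'injm f & f @* E = [set: 'cV['F_p]_n].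
Proof.
move=> p_pr abE cardE; apply/isogP.
rewrite (isog_abelem_card _ abE) mx_Fp_abelem //= cardsT card_mx muln1.
by rewrite card_Fp // cardE.
Qed.

(** Multiplying g and h by central elements does not change their commutator. *)
Lemma Aut_c_fix_der1 (gT : finGroupType) (s : {perm gT}) :
  s \in Aut_c gT -> {in [set: gT]^`(1), forall g, s g = g}.
Proof.
rewrite inE => /andP[sA /forallP sZ].
have fixM : group_set [set g | s g == g].
  apply/group_setP; split=> [|g h]; rewrite !inE.
    by rewrite -(autmE sA) morph1.
  by move=> /eqP sg /eqP sh; rewrite AutTM // sg sh.
suff: [set: gT]^`(1) \subset Group fixM.
  by move=> /subsetP sub g /sub; rewrite inE => /eqP.
rewrite derg1 gen_subG; apply/subsetP=> _ /imset2P[g h _ _ ->].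
have central k : exists2 w, s k = k * w & forall x, x ^ w = x /\ [~ x, w] = 1.
  exists (k^-1 * s k); first by rewrite mulKVg.
  move=> x; suff xw : commute x (k^-1 * s k).
    by rewrite conjgE xw mulKg; split=> //; apply/eqP/commgP.
  by have /centerP[_ /(_ x (in_setT x))/commute_sym] := sZ k.
have [v sg vC] := central g; have [w sh wC] := central h.
rewrite inE -(autmE sA) morphR ?inE //= autmE sg sh commMgJ commgMJ.
have [-> _] := vC ([~ g, w] * [~ g, h] ^ w); have [-> _] := wC [~ g, h].
have [_ ->] := wC g; rewrite mul1g.
have [_ vhw] := vC (h * w).
by rewrite -(invgK [~ v, _]) invg_comm vhw invg1 mulg1.
Qed.

Theorem theorem5p5 (p n : nat) (p_prime : prime p) (p_gt2 : (2 < p)%N)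
    (n_ge4 : (4 <= n)%N) (a : 'I_n -> 'I_n -> 'I_n -> 'F_p)
    (gT : finGroupType) (x : 'I_n -> gT)
    (presG : class2_presented a x)
    (class2 : nil_class [set: gT] = 2)
    (orderG : #|[set: gT]| = (p ^ (n + 'C(n, 2)))%N)
    (orderGFrat : #|[set: gT] / 'Phi([set: gT])| = (p ^ n)%N)
    (derFrat : [set: gT]^`(1) = 'Phi([set: gT]))
    (FratZ : 'Phi([set: gT]) = 'Z([set: gT]))
    (orderDer : #|[set: gT]^`(1)| = (p ^ 'C(n, 2))%N)
    (expDer : exponent [set: gT]^`(1) = p)
    (AutG : Aut [set: gT] = Aut_c gT) :
  exists H : {group coset_of (Hol gT)},
    [/\ H \subset T gT,
        ~~ abelian H,
        #|H| = ((p - 1) * p ^ ('C(n, 2) * 'C(n.+1, 2)))%N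
      & scalar_extension p ('C(n, 2) * 'C(n.+1, 2)) H].
Proof.
have n_gt0 : (0 < n)%N by apply: leq_trans n_ge4.
have pG : p.-group [set: gT] by rewrite /pgroup orderG pnatX pnat_id.
have [f injf imf] := abelem_isom_colvec p_prime (Phi_quotient_abelem pG) orderGFrat.
have abZ : p.-abelem [set: gT]^`(1).
  by rewrite abelemE // expDer dvdnn andbT /= derFrat FratZ center_abelian.
have [f' injf' imf'] := abelem_isom_colvec p_prime abZ orderDer.
have nPhi g : g \in 'N('Phi([set: gT])).
  by rewrite (subsetP (normal_norm (Phi_normal _))) ?inE.
have inQ g : coset 'Phi([set: gT]) g \in [set: gT] / 'Phi([set: gT]).
  by rewrite mem_quotient ?inE.
pose c g := f (coset 'Phi([set: gT]) g).
pose z := invm injf'.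
have inV w : w \in f' @* [set: gT]^`(1) by rewrite imf' inE.
have im_z w : z w \in 'Z([set: gT]).
  by have /morphimP[g _ gD ->] := inV w; rewrite /z invmE // -FratZ -derFrat.
have cM : {morph c : g h / g * h >-> (g + h)%R}.
  by move=> g h; rewrite /c morphM // morphM // inQ.
have c_surj v : exists g, c g = v.
  have : v \in f @* ([set: gT] / 'Phi([set: gT])) by rewrite imf inE.
  case/morphimP=> _ _ /morphimP[g _ _ ->] ->; by exists g.
have zD : {morph z : u v / (u + v)%R >-> u * v}.
  by move=> u v; rewrite -morphM ?inV.
have z_inj : injective z.
  by move=> u v; apply: (injmP (injm_invm injf')); apply: inV.
have z_central w g : commute (z w) g.
  by have /centerP[_ /(_ g (in_setT g))] := im_z w.
have c0P g : c g = 0%R <-> exists w, g = z w.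
  split=> [cg | [w ->]].
    have : coset 'Phi([set: gT]) g \in 'ker f by apply/kerP.
    rewrite (trivgP injf) => /set1P/coset_idr => /(_ (nPhi g)).
    by rewrite /= -derFrat => gD; exists (f' g); rewrite /z invmE.
  by rewrite /c coset_id ?morph1 // FratZ.
have Aut_c_id s g : s \in Aut [set: gT] -> c (s g) = c g.
  rewrite AutG inE => /andP[_ /forallP/(_ g)].
  rewrite -FratZ => sg; rewrite -(mulKVg g (s g)) cM {2}/c.
  by rewrite coset_id // morph1 addr0.
have Aut_z_id s w : s \in Aut [set: gT] -> s (z w) = z w.
  by rewrite AutG => /Aut_c_fix_der1; apply; rewrite derFrat FratZ.
by apply: (@multiple_holomorph_affine_subgroup p n _ gT c z);
  rewrite // bin_gt0 (leq_trans _ n_ge4).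
Qed.
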